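(* Let $p,p_1,\dots,p_n$ be distinct primes and let $G=A\rtimes\langle a\rangle$ be a finite group, where $o(a)=p^{\alpha}$ and $A=C_{p_1^{\alpha_1}}\times C_{p_2^{\alpha_2}}\times\cdots\times C_{p_n^{\alpha_n}}$ with $C_{p_i^{\alpha_i}}=\langle a_i\rangle$ cyclic of order $p_i^{\alpha_i}$. For each $i$, let $t_i\in\mathbb N$ with $t_i\leq p_i^{\alpha_i}-1$ and $(t_i,p_i)=1$ be determined by $$a^{-1}a_i^{-1}a=a_i^{t_i}.$$ Suppose that $p>p_i$ for all $i=1,\dots,n$. Then $G$ is a PNC-group if and only if $$v_{p_i}(t_i+1)=0\ \text{ or }\ v_{p_i}(t_i+1)=\alpha_i\qquad\text{for } i=1,2,\dots,n.$$
   Context: For a subgroup $H$ of $G$, $H^G$ denotes the normal closure of $H$ in $G$. $H$ is an NC-subgroup of $G$ if $H^GN_G(H)=G$; $G$ is a PNC-group if every subgroup of $G$ is an NC-subgroup of $G$. For a prime $\ell$ and a positive integer $k$, $v_\ell(k)$ is the exponent of $\ell$ in the prime factorization of $k$ ($0$ if $\ell\nmid k$). Every subgroup of the cyclic group $A$ is normal in $G$. *)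

(* Defs.v *)
From mathcomp Require Import all_boot all_fingroup.

Set Implicit Arguments.
Unset Strict Implicit.
Unset Printing Implicit Defensive.

Local Open Scope group_scope.

(* H^G, generated by all the conjugates h ^ g with h \in H and g \in G. *)
Definition normal_closure (gT : finGroupType) (G H : {set gT}) : {set gT} :=
  <<class_support H G>>.

Definition NC_subgroup (gT : finGroupType) (G H : {group gT}) : Prop :=
  H \subset G /\ normal_closure G H * 'N_G(H) = G.

Definition PNC_group (gT : finGroupType) (G : {group gT}) : Prop :=
  forall H : {group gT}, H \subset G -> NC_subgroup G H.

(* Checks that [normal_closure] is the least normal subgroup of G above H. *)
Section NormalClosureTheory.
Variables (gT : finGroupType) (G H : {group gT}).

Lemma sub_normal_closure : H \subset normal_closure G H.
Proof.
exact: subset_trans (sub_class_support _ _) (subset_gen _).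
Qed.

Lemma normal_closure_normal : H \subset G -> normal_closure G H <| G.
Proof.
move=> sHG; rewrite /normal /normal_closure gen_subG class_support_subG //=.
exact: norms_gen (class_support_norm _ _).
Qed.

Lemma normal_closure_min (K : {group gT}) :
  H \subset K -> K <| G -> normal_closure G H \subset K.
Proof.
move=> sHK /andP[_ nKG]; rewrite /normal_closure gen_subG.
exact: class_support_sub_norm.
Qed.

End NormalClosureTheory.

(* Main.v *)
(** The hypothesis [p > p_i] makes [p] coprime to
    [p_i ^ (alpha_i - 1) * (p_i - 1)], the order of the automorphism group of
    [<[a_ i]>], so the [p]-element [a] acts trivially on every [<[a_ i]>] and
    [G] is abelian. Both sides of the equivalence therefore always hold: every
    subgroup of [G] is normal, and [a_i ^ (t_i + 1) = 1] together with
    [t_i + 1 <= p_i ^ alpha_i] forces [t_i + 1 = p_i ^ alpha_i]. *)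
Require Import Defs.
From mathcomp Require Import all_boot all_fingroup.
From mathcomp Require Import cyclic center.

Local Open Scope group_scope.

(** The automorphism of [<[y]>] induced by [x] has order dividing both [#[x]] and the order [totient
    #[y]] of [Aut <[y]>]. *)
Lemma commute_coprime_totient (gT : finGroupType) (x y : gT) :
  x \in 'N(<[y]>) -> coprime #[x] (totient #[y]) -> commute x y.
Proof.
move=> nyx co_x.
have: conj_aut <[y]> x = 1.
  apply/eqP; rewrite -order_eq1 -dvdn1 -(eqP co_x) dvdn_gcd morph_order //=.
  by rewrite -(card_Aut_cycle y) order_dvdG // Aut_aut.
move/(congr1 (fun f : {perm gT} => f y)).
rewrite perm1 norm_conj_autE ?cycle_id // => /conjg_fixP/commgP.
exact: commute_sym.
Qed.

Lemma coprime_totient_pfactor (p q e : nat) :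
  prime p -> prime q -> q < p -> coprime p (totient (q ^ e)).
Proof.
move=> p_pr q_pr lt_qp; case: e => [|e]; first exact: coprimen1.
rewrite totient_pfactor // coprimeMr; apply/andP; split.
  rewrite prime_coprime // gtnNdvd ?(leq_ltn_trans (leq_pred q)) //.
  by rewrite -subn1 subn_gt0 prime_gt1.
by apply: coprimeXr; rewrite prime_coprime // gtnNdvd ?prime_gt0.
Qed.

Lemma abelian_PNC_group (gT : finGroupType) (G : {group gT}) :
  abelian G -> PNC_group G.
Proof.
move=> abG H sHG; split=> //.
have /andP[sKG _] := normal_closure_normal sHG.
rewrite (setIidPl (sub_abelian_norm abG sHG)).
by rewrite /normal_closure in sKG *; apply: mulSGid.
Qed.

Theorem theorem4p7 (gT : finGroupType) (G A : {group gT}) (a : gT)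
    (p alpha n : nat) (p_ alpha_ t_ : 'I_n -> nat) (a_ : 'I_n -> gT)
    (p_prime : prime p)
    (pi_prime : forall i, prime (p_ i))
    (pi_distinct : injective p_)
    (p_distinct : forall i, p_ i != p)
    (defG : A ><| <[a]> = G)
    (oa : #[a] = (p ^ alpha)%N)
    (defA : \big[dprod/1]_(i < n) <[a_ i]> = A)
    (oai : forall i, #[a_ i] = (p_ i ^ alpha_ i)%N)
    (ti_le : forall i, (t_ i <= p_ i ^ alpha_ i - 1)%N)
    (ti_coprime : forall i, coprime (t_ i) (p_ i))
    (ti_def : forall i, a^-1 * (a_ i)^-1 * a = a_ i ^+ t_ i)
    (p_gt : forall i, (p_ i < p)%N) :
  PNC_group G <->
  (forall i : 'I_n,
     logn (p_ i) (t_ i + 1) = 0%N \/ logn (p_ i) (t_ i + 1) = alpha_ i).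
Proof.
have caai i : commute a (a_ i).
  apply: commute_coprime_totient; last first.
    by rewrite oa oai coprimeXl ?coprime_totient_pfactor.
  (* Inverting [a_ i ^ a] gives the left side of [ti_def], a power of [a_ i]. *)
  rewrite -cycle_subG norms_cycle -groupV -conjVg conjgE mulgA ti_def.
  exact: mem_cycle.
split=> [_ i | _]; [right | apply: abelian_PNC_group].
  have q_gt0: (0 < p_ i ^ alpha_ i)%N by rewrite expn_gt0 prime_gt0.
  suff -> : (t_ i + 1 = p_ i ^ alpha_ i)%N by exact: pfactorK.
  apply/eqP; rewrite eqn_leq; apply/andP; split.
    by rewrite addnC -leq_subRL.
  apply: dvdn_leq; first by rewrite addn1.
  rewrite -oai order_dvdn expgD expg1 -ti_def -mulgA caai.
  by rewrite -mulgA mulKg mulVg.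
(* The centre of a direct product is the product of the centres, and each cyclic factor is its own
   centre. *)
have abA: abelian A.
  apply/center_idP; rewrite -(center_bigdprod defA) -[RHS]defA.
  by apply: eq_bigr => i _; apply/center_idP/cycle_abelian.
have [_ <- _ _] := sdprodP defG.
(* It remains that [a] centralizes [A], which can be checked on the generators [a_ i]. *)
rewrite abelianM abA cycle_abelian centsC cent_cycle -(bigdprodWY defA) gen_subG.
apply/bigcupsP=> i _; rewrite cycle_subG; apply/cent1P.
exact/commute_sym/caai.
Qed.
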